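(* For every positive integer $k$ there is an algorithm which, given any set $S$ of $n$ points in $\mathbb{R}^2$, computes a dominating set $S'\subseteq S$ of $S$ with $|S'|\le (1+\frac{1}{k})^2\,|OPT|$, where $OPT$ is a minimum dominating set of $S$, and which runs in $n^{O(k)}$ time.
   Context: For a finite point set $S\subset\mathbb{R}^2$, a dominating set of $S$ is a subset $S'\subseteq S$ such that every point of $S$ lies in at least one disk of radius $1$ centered at a point of $S'$, i.e. every point of $S$ is at Euclidean distance at most $1$ from some point of $S'$. A minimum dominating set is a dominating set of minimum cardinality. *)

(* Defs.v *)
From mathcomp Require Import all_boot all_order all_algebra.
From mathcomp Require Import finmap.
From mathcomp Require Import reals.

Set Implicit Arguments.
Unset Strict Implicit.
Unset Printing Implicit Defensive.

Import Order.TTheory GRing.Theory Num.Theory.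

Local Open Scope fset_scope.
Local Open Scope ring_scope.

Section UnitDiskDomination.
Variable R : realType.
Implicit Types (S D : {fset R * R}) (p q : R * R).

(* The library norm on R * R is the maximum norm, hence the explicit formula. *)
Definition edist p q : R :=
  Num.sqrt ((p.1 - q.1) ^+ 2 + (p.2 - q.2) ^+ 2).

Definition dominating_set S D : Prop :=
  D `<=` S /\ forall p, p \in S -> exists2 q, q \in D & edist q p <= 1.

Definition minimum_dominating_set S D : Prop :=
  dominating_set S D /\
  forall D', dominating_set S D' -> (#|` D| <= #|` D'|)%N.

End UnitDiskDomination.

(* Programs of a real RAM. There is an unbounded memory of natural numbers and
   an unbounded memory of real numbers, both addressed by natural numbers;
   addresses may be computed, and loads may be nested (indirect addressing).
   The instruction set is restricted so that unit cost is a meaningful measure: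
   - natural numbers are only added and (truncatedly) subtracted, so that a
     computation of length t on n points only produces natural numbers of
     O(t + log n) bits, for a fixed program;
   - real numbers influence the rest of the computation only through
     comparisons: there is no floor and no conversion to natural numbers;
   - 0 and 1 are the only real constants, so that a program cannot carry an
     infinite amount of information in a real literal. *)

Inductive nexp : Type :=
  | NConst of nat
  | NLoad of nexp
  | NAdd of nexp & nexp
  | NSub of nexp & nexp.

Inductive rexp : Type :=
  | RZero
  | ROne
  | RLoad of nexp
  | RAdd of rexp & rexp
  | RSub of rexp & rexp
  | RMul of rexp & rexp
  | RDiv of rexp & rexp.

Inductive bexp : Type :=
  | BNle of nexp & nexp
  | BRle of rexp & rexp
  | BNot of bexp
  | BAnd of bexp & bexp.

Inductive cmd : Type :=
  | Skip
  | NStore of nexp & nexp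
  | RStore of nexp & rexp
  | Seq of cmd & cmd
  | If of bexp & cmd & cmd
  | While of bexp & cmd.

(* Evaluating an expression costs its number of nodes, even for the operand of
   a Boolean conjunction that could be skipped. *)
Fixpoint ncost (e : nexp) : nat :=
  match e with
  | NConst _ => 1
  | NLoad a => (ncost a).+1
  | NAdd e1 e2 | NSub e1 e2 => (ncost e1 + ncost e2).+1
  end.

Fixpoint rcost (e : rexp) : nat :=
  match e with
  | RZero | ROne => 1
  | RLoad a => (ncost a).+1
  | RAdd e1 e2 | RSub e1 e2 | RMul e1 e2 | RDiv e1 e2 =>
      (rcost e1 + rcost e2).+1
  end.

Fixpoint bcost (b : bexp) : nat :=
  match b with
  | BNle e1 e2 => (ncost e1 + ncost e2).+1
  | BRle e1 e2 => (rcost e1 + rcost e2).+1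
  | BNot b1 => (bcost b1).+1
  | BAnd b1 b2 => (bcost b1 + bcost b2).+1
  end.

Section Semantics.
Variable R : realType.

Record state : Type := State { nmem : nat -> nat; rmem : nat -> R }.

Implicit Type st : state.

Definition update (T : Type) (m : nat -> T) (a : nat) (v : T) : nat -> T :=
  fun i => if i == a then v else m i.

Fixpoint neval (st : state) (e : nexp) : nat :=
  match e with
  | NConst c => c
  | NLoad a => nmem st (neval st a)
  | NAdd e1 e2 => (neval st e1 + neval st e2)%N
  | NSub e1 e2 => (neval st e1 - neval st e2)%N
  end.

Fixpoint reval (st : state) (e : rexp) : R :=
  match e with
  | RZero => 0
  | ROne => 1
  | RLoad a => rmem st (neval st a)
  | RAdd e1 e2 => reval st e1 + reval st e2
  | RSub e1 e2 => reval st e1 - reval st e2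
  | RMul e1 e2 => reval st e1 * reval st e2
  | RDiv e1 e2 => reval st e1 / reval st e2
  end.

Fixpoint beval (st : state) (b : bexp) : bool :=
  match b with
  | BNle e1 e2 => (neval st e1 <= neval st e2)%N
  | BRle e1 e2 => reval st e1 <= reval st e2
  | BNot b1 => ~~ beval st b1
  | BAnd b1 b2 => beval st b1 && beval st b2
  end.

(* [exec P st t st']: started in st, P terminates after t steps in st'.
   By exec_det below, t and st' are determined by P and st. *)
Inductive exec : cmd -> state -> nat -> state -> Prop :=
  | ExecSkip st : exec Skip st 1 st
  | ExecNStore st a e :
      exec (NStore a e) st (ncost a + ncost e).+1
        (State (update (nmem st) (neval st a) (neval st e)) (rmem st))
  | ExecRStore st a e :
      exec (RStore a e) st (ncost a + rcost e).+1
        (State (nmem st) (update (rmem st) (neval st a) (reval st e)))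
  | ExecSeq st1 st2 st3 P1 P2 t1 t2 :
      exec P1 st1 t1 st2 -> exec P2 st2 t2 st3 ->
      exec (Seq P1 P2) st1 (t1 + t2) st3
  | ExecIfTrue st st' b P1 P2 t :
      beval st b -> exec P1 st t st' ->
      exec (If b P1 P2) st (bcost b + t).+1 st'
  | ExecIfFalse st st' b P1 P2 t :
      ~~ beval st b -> exec P2 st t st' ->
      exec (If b P1 P2) st (bcost b + t).+1 st'
  | ExecWhileFalse st b P :
      ~~ beval st b -> exec (While b P) st (bcost b).+1 st
  | ExecWhileTrue st1 st2 st3 b P t1 t2 :
      beval st1 b -> exec P st1 t1 st2 -> exec (While b P) st2 t2 st3 ->
      exec (While b P) st1 (bcost b + t1 + t2).+1 st3.

Lemma exec_det P st t1 st1 :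
  exec P st t1 st1 ->
  forall t2 st2, exec P st t2 st2 -> t1 = t2 /\ st1 = st2.
Proof.
elim=> {P st t1 st1}; try by move=> ? ? ? ? ? H; inversion H.
- by move=> st t2 st2 H; inversion H.
- move=> s1 s2 s3 P1 P2 t1 t2 _ IH1 _ IH2 t st H; inversion H as
    [| | |? s4 ? ? ? t3 t4 E1 E2| | | |]; subst.
  have [? ?] := IH1 _ _ E1; subst.
  by have [? ?] := IH2 _ _ E2; subst.
- move=> st st' b P1 P2 t Hb _ IH t2 st2 H; inversion H as
    [| | | |? ? ? ? ? ? Hb' E|? ? ? ? ? ? Hb' E| |]; subst.
    by have [-> ->] := IH _ _ E.
  by rewrite Hb in Hb'.
- move=> st st' b P1 P2 t Hb _ IH t2 st2 H; inversion H as
    [| | | |? ? ? ? ? ? Hb' E|? ? ? ? ? ? Hb' E| |]; subst.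
    by rewrite Hb' in Hb.
  by have [-> ->] := IH _ _ E.
- move=> st b P Hb t2 st2 H; inversion H as
    [| | | | | | |? ? ? ? ? ? ? Hb' E1 E2]; subst => //.
  by rewrite Hb' in Hb.
- move=> s1 s2 s3 b P t1 t2 Hb _ IH1 _ IH2 t st H; inversion H as
    [| | | | | |? ? ? Hb'|? s4 ? ? ? t3 t4 Hb' E1 E2]; subst.
    by rewrite Hb in Hb'.
  have [? ?] := IH1 _ _ E1; subst.
  by have [? ?] := IH2 _ _ E2; subst.
Qed.

(* A point set is given to a program as a list of its elements: the number of
   points is at address 0 of the natural memory, and the i-th point occupies
   addresses 2i and 2i+1 of the real memory. All other cells contain 0. *)
Definition input (s : seq (R * R)) : state :=
  State (fun a => if a == 0 then size s else 0)%N
        (fun a => let p := nth (0, 0) s a./2 in if odd a then p.2 else p.1).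

(* A program outputs a subset of its input: the i-th point is selected when
   address i of the natural memory finally contains a nonzero value. *)
Definition output (s : seq (R * R)) (st : state) : {fset R * R} :=
  [fset p in mask (mkseq (fun i => nmem st i != 0)%N (size s)) s].

End Semantics.

(* Main.v *)
(* A list L of point sets is grown from the empty set. A step, driven by
   a tuple u of numbers, appends the smallest set W :|: T_u (W in L) that
   dominates Q_u, where T_u is the set of the O(k) points listed in u and
   Q_u = {p : y p < y a, or y p < y b and x p < x c} for three further entries
   a, b, c of u. All tuples are tried, again and again in (n + 2)^2 rounds; the
   last step looks for the smallest set dominating everything.

   This contains, for every shift, the shifting argument of Hochbaum and Maass
   combined with a sweep. Cut the plane into half-unit rows and columns, and
   group the rows into bands of 4k consecutive ones. A minimum set D_b dominating
   one band has O(k) points in any five adjacent columns, since more of them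
   could be replaced by one point per occupied cell nearby. So D_b is found by
   a dynamic program over the columns whose state T_u is D_b restricted to five
   columns, with Q_u the bands and columns treated so far, and the bands can be
   chained. A point of an optimal solution serves two bands for at most 4 of the
   4k shifts, so that some shift gives at most (1 + 1/k) |OPT| points. As the
   program never needs to know the rows and columns, no floor is computed. *)
Require Import Defs.
From mathcomp Require Import all_boot all_order all_algebra.
From mathcomp Require Import finmap.
From mathcomp Require Import reals zify ring lra.

Set Implicit Arguments.
Unset Strict Implicit.
Unset Printing Implicit Defensive.

Import Order.TTheory GRing.Theory Num.Theory.

Local Open Scope nat_scope.

(* The real memory only ever holds the input, so assertions are predicates on
   the natural memory and r is fixed. *)
Section Logic.
Variables (R : realType) (r : nat -> R).
Implicit Types (m : nat -> nat) (P : cmd) (Q : (nat -> nat) -> Prop).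

Definition wp P T m Q : Prop :=
  exists t m', [/\ exec P (State m r) t (State m' r), t <= T & Q m'].

Lemma wp_conseq P T T' m Q Q' :
  wp P T m Q -> T <= T' -> (forall m', Q m' -> Q' m') -> wp P T' m Q'.
Proof.
move=> [t [m' [ex le_t Qm]]] le_T QQ'; exists t, m'.
by split; [|apply: leq_trans le_T|apply: QQ'].
Qed.

Lemma wp_skip m Q : Q m -> wp Skip 1 m Q.
Proof. by move=> Qm; exists 1, m; split => //; constructor. Qed.

Lemma wp_store a e m Q :
  Q (update m (neval (State m r) a) (neval (State m r) e)) ->
  wp (NStore a e) (ncost a + ncost e).+1 m Q.
Proof.
by move=> Qm; eexists _, _; split; [apply: (ExecNStore (State m r))| |exact: Qm].
Qed.

Lemma wp_seq P1 P2 T1 T2 m Q :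
  wp P1 T1 m (fun m1 => wp P2 T2 m1 Q) -> wp (Seq P1 P2) (T1 + T2) m Q.
Proof.
move=> [t1 [m1 [ex1 le1 [t2 [m2 [ex2 le2 Qm]]]]]].
by exists (t1 + t2), m2; split; [apply: ExecSeq ex2|apply: leq_add|].
Qed.

Lemma wp_if b P1 P2 T m Q :
  (beval (State m r) b -> wp P1 T m Q) ->
  (~~ beval (State m r) b -> wp P2 T m Q) ->
  wp (If b P1 P2) (bcost b + T).+1 m Q.
Proof.
case: (boolP (beval _ _)) => hb H1 H2.
  have [t [m' [ex le Qm]]] := H1 isT.
  by exists (bcost b + t).+1, m'; split; [exact: ExecIfTrue|lia|].
have [t [m' [ex le Qm]]] := H2 isT.
by exists (bcost b + t).+1, m'; split; [exact: ExecIfFalse|lia|].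
Qed.

Lemma wp_while (I : nat -> (nat -> nat) -> Prop) N b P T m :
  (forall k m, k < N -> I k m ->
     beval (State m r) b /\ wp P T m (I k.+1)) ->
  (forall m, I N m -> ~~ beval (State m r) b) ->
  I 0 m -> wp (While b P) (N * (bcost b + T).+1 + (bcost b).+1) m (I N).
Proof.
move=> Hs He I0.
suff main d k m1 : d + k = N -> I k m1 ->
    wp (While b P) (d * (bcost b + T).+1 + (bcost b).+1) m1 (I N).
  exact: (main N 0 m (addn0 N) I0).
elim: d k m1 => [|d IHd] k m1 dk Ik.
  rewrite -dk in He *; exists (bcost b).+1, m1; split=> //.
  by constructor; apply: He.
have [hb [t1 [m2 [ex1 le1 I1]]]] := Hs k m1 ltac:(lia) Ik.
have [t2 [m3 [ex2 le2 I2]]] := IHd k.+1 m2 ltac:(lia) I1.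
exists (bcost b + t1 + t2).+1, m3; split=> //; last lia.
exact: ExecWhileTrue ex1 ex2.
Qed.

Definition reg c : nexp := NLoad (NConst c).

Definition for_ i bnd P : cmd :=
  Seq (NStore (NConst i) (NConst 0))
    (While (BNle (NAdd (reg i) (NConst 1)) bnd)
       (Seq P (NStore (NConst i) (NAdd (reg i) (NConst 1))))).

Lemma wp_for (I : nat -> (nat -> nat) -> Prop) N i bnd P T m :
  (forall k m, I k m -> m i = k /\ neval (State m r) bnd = N) ->
  I 0 (update m i 0) ->
  (forall k m, k < N -> I k m ->
     wp P T m (fun m' => m' i = k /\ I k.+1 (update m' i k.+1))) ->
  wp (for_ i bnd P) (N * (T + ncost bnd + 12) + (ncost bnd + 9)) m (I N).
Proof.
move=> HI I0 Hs.
apply: wp_conseq; first apply: wp_seq.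
- apply: wp_store => /=.
  apply: (wp_while (I := I) (N := N)); last exact: I0; last first.
    by move=> m' /HI [/= -> ->]; rewrite addn1 ltnn.
  move=> k m' lt_k Ik; have [/= -> ->] := HI _ _ Ik; rewrite addn1; split=> //.
  apply: wp_seq; apply: wp_conseq (Hs _ _ lt_k Ik) (leqnn _) _ => m1 [mi Im1].
  by apply: wp_store; rewrite /= mi addn1.
- by rewrite /=; lia.
- by [].
Qed.

Definition agree (X : seq nat) m m' := forall a, a \notin X -> m' a = m a.

Definition count_ c i P b : cmd :=
  Seq (NStore (NConst c) (NConst 0))
    (for_ i (reg 1)
      (Seq P (If b (NStore (NConst c) (NAdd (reg c) (NConst 1))) Skip))).

Lemma count_iotaS (p : pred nat) k :
  count p (iota 0 k.+1) = count p (iota 0 k) + p k.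
Proof. by rewrite -(addn1 k) iotaD count_cat /= add0n addn0. Qed.

Lemma wp_count n c i X P b (beta : pred nat) T m :
  m 1 = n -> 1 \notin c :: i :: X -> c != i -> c \notin X -> i \notin X ->
  (forall k m', k < n -> agree (c :: i :: X) m m' -> m' i = k ->
     wp P T m' (fun m2 => agree X m' m2 /\ beval (State m2 r) b = beta k)) ->
  wp (count_ c i P b) (n * (T + bcost b + 21) + 14) m
    (fun m' => agree (c :: i :: X) m m' /\ m' c = count beta (iota 0 n)).
Proof.
move=> m1 nX ci cX iX HP.
have mem3 a : a \notin c :: i :: X -> [/\ a == c = false, a == i = false & a \notin X].
  by rewrite !inE; case: (a == c); case: (a == i).
have [n1c n1i n1X] := mem3 _ nX.
pose I k m' := [/\ agree (c :: i :: X) m m', m' i = k & m' c = count beta (iota 0 k)].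
apply: wp_conseq; first apply: wp_seq.
- apply: wp_store => /=.
  apply: (wp_for (I := I) (N := n)
    (T := T + (bcost b + 6).+1)).
  + move=> k m' [ag mi _]; split=> //=; by rewrite ag.
  + split; rewrite /= /update ?eqxx //; last by rewrite (negbTE ci).
    by move=> a /mem3 [-> -> _].
  + move=> k m' lt_k [ag mi mc].
    apply: wp_seq; apply: wp_conseq (HP _ _ lt_k ag mi) (leqnn _) _ => m2 [ag2 bb].
    have m2c: m2 c = m' c by apply: ag2.
    have m2i: m2 i = m' i by apply: ag2.
    apply: (@wp_if _ _ _ 6); rewrite bb => hb.
      apply: wp_conseq; first apply: wp_store; last first.
      * by move=> m3; apply.
      * by [].
      rewrite /= /update eq_sym (negbTE ci) m2i; split=> //; split.
      * move=> a aX; have [-> -> aX'] := mem3 _ aX.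
        by rewrite ag2 // ag.
      * by rewrite eqxx.
      * by rewrite (negbTE ci) eqxx m2c mc count_iotaS hb.
    apply: wp_conseq; first apply: wp_skip; last first.
    * by move=> m3; apply.
    * by [].
    rewrite /update m2i; split=> //; split.
    * move=> a aX; have [_ -> aX'] := mem3 _ aX.
      by rewrite ag2 // ag.
    * by rewrite eqxx.
    * by rewrite (negbTE ci) m2c mc count_iotaS (negbTE hb) addn0.
- by rewrite /=; nia.
- by move=> m' [].
Qed.

Definition fill b : cmd :=
  for_ 4 (reg 1)
    (If b (NStore (NAdd (reg 2) (reg 4)) (NConst 1))
          (NStore (NAdd (reg 2) (reg 4)) (NConst 0))).

Definition agree_block (X : seq nat) e n m m' :=
  forall a, a \notin X -> ~~ (e <= a < e + n) -> m' a = m a.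

Lemma wp_fill n e b (beta : pred nat) m :
  m 1 = n -> m 2 = e -> 4 < e ->
  (forall k m', k < n -> agree_block [:: 4] e n m m' -> m' 4 = k ->
     beval (State m' r) b = beta k) ->
  wp (fill b) (n * (bcost b + 22) + 11) m
    (fun m' => agree_block [:: 4] e n m m' /\
               forall k, k < n -> m' (e + k) = beta k).
Proof.
move=> m1 m2 e4 Hb.
pose I k m' := [/\ agree_block [:: 4] e n m m', m' 4 = k &
                   forall j, j < k -> j < n -> m' (e + j) = beta j].
have st k m' : k < n -> I k m' -> I k.+1 (update (update m' (e + k) (beta k)) 4 k.+1).
  move=> lt_k [ag mi mj]; split=> //.
    move=> a; rewrite inE => /negbTE a4 ae; rewrite /update a4.
    have -> : (a == e + k) = false by apply/eqP; lia.
    by rewrite ag // inE a4.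
  move=> j lt_j ltn; rewrite /update.
  have -> : (e + j == 4) = false by apply/eqP; lia.
  rewrite eqn_add2l; case: eqP => [-> //|/eqP jk].
  by apply: mj => //; lia.
apply: wp_conseq; first apply: (wp_for (I := I) (N := n) (T := (bcost b + 7).+1)).
- move=> k m' [ag mi _]; split=> //=; rewrite ag ?inE //; lia.
- split=> // a; rewrite inE /update => /negbTE -> //.
- move=> k m' lt_k Ik; have [ag mi mj] := Ik.
  have m'2 : m' 2 = e by rewrite ag ?inE //; lia.
  have k4 : (4 == e + k) = false by apply/eqP; lia.
  apply: (@wp_if _ _ _ 7); rewrite (Hb _ _ lt_k ag mi) => hb.
    apply: wp_conseq; first apply: wp_store; last by move=> m3; apply.
      rewrite /= mi m'2; split; first by rewrite /update k4.
      by have := st _ _ lt_k Ik; rewrite hb.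
    by [].
  apply: wp_conseq; first apply: wp_store; last by move=> m3; apply.
    rewrite /= mi m'2; split; first by rewrite /update k4.
    by have := st _ _ lt_k Ik; rewrite (negbTE hb).
  by [].
- rewrite /=; nia.
- by move=> m' [ag _ mj]; split=> // k lt_k; apply: mj.
Qed.

End Logic.

Section Step.
Variables (R : realType) (r : nat -> R) (n B : nat).
Implicit Types (m : nat -> nat) (u : nat -> nat) (L : seq {set 'I_n}).
Implicit Types (C Q W : {set 'I_n}).

Definition px i : R := r (i + i).
Definition py i : R := r (i + i + 1).
Definition near q p : bool :=
  ((px q - px p) * (px q - px p) + (py q - py p) * (py q - py p) <= 1)%R.
Definition thr (f : nat -> R) p a : bool := (n <= a) || ~~ (f a <= f p)%R.
Definition inQ u p := thr py p (u 0) || (thr py p (u 1) && thr px p (u 2)).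
Definition inT u i := has (fun d => u d == i) (iota 3 B).
Definition Qset u : {set 'I_n} := [set p : 'I_n | inQ u p].
Definition Tset u : {set 'I_n} := [set p : 'I_n | inT u p].
Definition domi C Q : bool := [forall p in Q, exists q in C, near q p].

Definition good L u W : Prop :=
  [/\ Tset u \subset W, domi W (Qset u) &
      forall W0, W0 \in L -> domi (W0 :|: Tset u) (Qset u) ->
        #|W| <= #|W0 :|: Tset u|].

Definition eqE i j := BAnd (BNle (reg i) (reg j)) (BNle (reg j) (reg i)).
Definition orE b1 b2 := BNot (BAnd (BNot b1) (BNot b2)).
Definition trueE := BNle (NConst 0) (NConst 0).
Definition notinE i :=
  foldr (fun d b => BAnd (BNot (eqE (11 + d) i)) b) trueE (iota 3 B).
Definition cE i :=
  BNot (BAnd (BNle (NLoad (NAdd (reg 3) (reg i))) (NConst 0)) (notinE i)).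
Definition xE i := RLoad (NAdd (reg i) (reg i)).
Definition yE i := RLoad (NAdd (NAdd (reg i) (reg i)) (NConst 1)).
Definition nearE i j :=
  BRle (RAdd (RMul (RSub (xE i) (xE j)) (RSub (xE i) (xE j)))
             (RMul (RSub (yE i) (yE j)) (RSub (yE i) (yE j)))) ROne.
Definition thrE (fE : nat -> rexp) i a :=
  orE (BNle (reg 1) (reg a)) (BNot (BRle (fE a) (fE i))).
Definition qE i := orE (thrE yE i 11) (BAnd (thrE yE i 12) (thrE xE i 13)).

Lemma beval_notinE m i :
  beval (State m r) (notinE i) = ~~ inT (fun d => m (11 + d)) (m i).
Proof.
rewrite /notinE /inT; elim: (iota 3 B) => //= d l ->.
by rewrite negb_or -eqn_leq.
Qed.

Lemma beval_cE m i :
  beval (State m r) (cE i) =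
  (m (m 3 + m i) != 0) || inT (fun d => m (11 + d)) (m i).
Proof. by rewrite /cE /= beval_notinE leqn0 negb_and negbK. Qed.

Lemma bcost_cE i : bcost (cE i) = 13 * B + 13.
Proof.
rewrite /=; suff -> : bcost (notinE i) = 13 * B + 3 by lia.
rewrite /notinE -[in RHS](size_iota 3 B).
by elim: (iota 3 B) => //= d l ->; lia.
Qed.

Lemma beval_qE m i : m 1 = n ->
  beval (State m r) (qE i) = inQ (fun d => m (11 + d)) (m i).
Proof.
by move=> m1; rewrite /= m1 /inQ !negb_and !negbK negb_or !negbK.
Qed.

Lemma card_set_count (beta : pred nat) :
  #|[set i : 'I_n | beta i]| = count beta (iota 0 n).
Proof.
by rewrite -sum1dep_card -sum1_count -[in RHS](subn0 n) -/(index_iota 0 n) big_mkord.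
Qed.

Definition setof m a : {set 'I_n} := [set i : 'I_n | m (a + i) != 0].

Lemma eq_setof m m' a : (forall i, i < n -> m' (a + i) = m (a + i)) ->
  setof m' a = setof m a.
Proof. by move=> eqm; apply/setP => i; rewrite !inE eqm. Qed.

(* Cell 1 holds n, cell 2 the end of the list, cell 3 the entry of the list
   under consideration, cell 10 the size of the best set so far (kept just after
   the end of the list); cells 4 to 9 are loop indices and counters, and the
   entries of the tuple u start at cell 11. The first three are the thresholds
   a, b, c (a value >= n means infinity), the next B are the points of T_u, and
   the last two only count the rounds. *)
Definition nregs := B + 16.
Definition base := n + nregs.

Definition candidate : cmd :=
  Seq (count_ 7 4 Skip (cE 4))
 (Seq (count_ 8 5 (count_ 9 6 Skip (BAnd (cE 6) (nearE 6 5)))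
        (BAnd (qE 5) (BNle (reg 9) (NConst 0))))
 (Seq (If (BAnd (BNle (reg 8) (NConst 0)) (BNle (NAdd (reg 7) (NConst 1)) (reg 10)))
        (Seq (fill (cE 4)) (NStore (NConst 10) (reg 7)))
        Skip)
   (NStore (NConst 3) (NAdd (NAdd (reg 3) (reg 1)) (NConst 1))))).

Definition step : cmd :=
  Seq (fill trueE)
 (Seq (NStore (NConst 10) (reg 1))
 (Seq (NStore (NConst 3) (NAdd (reg 1) (NConst nregs)))
 (Seq (While (BNle (NAdd (reg 3) (NConst 1)) (reg 2)) candidate)
   (NStore (NConst 2) (NAdd (NAdd (reg 2) (reg 1)) (NConst 1)))))).

Definition digits m : nat -> nat := fun d => m (11 + d).

Definition scratch : seq nat := [:: 3; 4; 5; 6; 7; 8; 9; 10].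

Definition rep m L : Prop :=
  [/\ m 1 = n, m 2 = base + size L * n.+1 &
      forall k, k < size L -> setof m (base + k * n.+1) = nth set0 L k].

Definition best_of m0 L (e k : nat) m : Prop :=
  [/\ agree_block scratch e n m0 m, m 3 = base + k * n.+1,
      m 10 = #|setof m e| &
      [/\ Tset (digits m0) \subset setof m e,
          domi (setof m e) (Qset (digits m0)) &
          forall j, j < k ->
            domi (nth set0 L j :|: Tset (digits m0)) (Qset (digits m0)) ->
            #|setof m e| <= #|nth set0 L j :|: Tset (digits m0)| ]].

Lemma digits_agree m m' e : base <= e -> agree_block scratch e n m m' ->
  forall d, d < B.+3 -> digits m' d = digits m d.
Proof.
move=> le_e ag d lt_d; apply: ag; rewrite /base /nregs in le_e; last lia.
by rewrite !inE; lia.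
Qed.

Lemma eq_inT u u' : (forall d, d < B.+3 -> u' d = u d) -> inT u' =1 inT u.
Proof.
move=> equ i; apply: eq_in_has => d; rewrite mem_iota => ?.
by rewrite equ //; lia.
Qed.

Lemma eq_inQ u u' : (forall d, d < B.+3 -> u' d = u d) -> inQ u' =1 inQ u.
Proof. by move=> equ i; rewrite /inQ !equ. Qed.

Definition Tcand := (n * (13 * B + 36) + 14) +
  ((n * (n * (13 * B + 101) + 200) + 14) + ((n * (13 * B + 40) + 60) + 9)).

Lemma wp_candidate m0 L k m : rep m0 L -> k < size L ->
  best_of m0 L (base + size L * n.+1) k m ->
  wp r candidate Tcand m (best_of m0 L (base + size L * n.+1) k.+1).
Proof.
move=> [m01 m02 m0L] lt_k [ag m3 m10 [subT dom best]].
set e := base + size L * n.+1 in ag m10 subT dom best *.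
have le_e : base <= e by rewrite /e; lia.
have e16 : 15 < e by rewrite /base /nregs in le_e; lia.
have m1 : m 1 = n by rewrite ag //; lia.
set u := digits m0 in subT dom best *.
pose beta i := (m (base + k * n.+1 + i) != 0) || inT u i.
set C := nth set0 L k :|: Tset u.
have ke i : i < n -> base + k * n.+1 + i < e by rewrite /e; nia.
have CE (i : 'I_n) : (i \in C) = beta i.
  rewrite !inE -m0L // inE /beta ag //; last by have := ke i (ltn_ord i); lia.
  by rewrite !inE /base /nregs; lia.
have cEE m' i c : (forall a : nat, a \notin 4 :: 5 :: 6 :: 7 :: 8 :: 9 :: nil ->
      ~~ (e <= a < e + n) -> m' a = m a) -> i < n -> m' c = i ->
    beval (State m' r) (cE c) = beta i.
  move=> ag' lt_i m'c; rewrite beval_cE m'c (ag' 3) //; last lia.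
  have lt_e := ke _ lt_i; rewrite m3 ag'; last by lia.
    congr (_ || _); apply: eq_inT => d lt_d.
    have -> : m' (11 + d) = m (11 + d).
      by apply: ag'; [rewrite !inE; lia | rewrite /base /nregs in le_e; lia].
    exact: (digits_agree le_e ag lt_d).
  by rewrite !inE /base /nregs; lia.
have sub_ag X m' : {subset X <= [:: 4; 5; 6; 7; 8; 9]} -> agree X m m' ->
    agree [:: 4; 5; 6; 7; 8; 9] m m'.
  by move=> sX h a aX; apply: h; apply: contra aX; apply: sX.
rewrite /Tcand.
apply: wp_seq; apply: wp_conseq.
- apply: (wp_count (n := n) (X := [::]) (beta := beta) (T := 1)) => //.
  move=> i m' lt_i ag' m'4; apply: wp_skip; split=> //.
  apply: cEE => // a aX _; move: a aX; apply: (sub_ag [:: 7; 4]) => //.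
  by move=> a; rewrite !inE; lia.
- by rewrite bcost_cE; lia.
move=> ma [aga ma7].
apply: wp_seq; apply: wp_conseq.
- pose gamma p := inQ u p && (count (fun q => beta q && near q p) (iota 0 n) <= 0).
  apply: (wp_count (n := n) (X := [:: 9; 6]) (beta := gamma)).
  + by rewrite aga.
  + by [].
  + by [].
  + by [].
  + by [].
  move=> p m' lt_p ag' m'5.
  apply: wp_conseq.
  * apply: (wp_count (n := n) (X := [::]) (T := 1)
      (beta := fun q => beta q && near q p)) => //.
      by rewrite ag' // aga.
    move=> q m2 lt_q ag2 m26; apply: wp_skip; split=> //.
    have ag2' : agree [:: 4; 5; 6; 7; 8; 9] m m2.
      move=> a; rewrite !inE => aX; rewrite ag2 ?inE; last lia.
      by rewrite ag' ?inE; [rewrite aga ?inE //; lia | lia].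
    have -> : beval (State m2 r) (BAnd (cE 6) (nearE 6 5)) =
        beval (State m2 r) (cE 6) && near (m2 6) (m2 5) by [].
    rewrite (cEE _ q) //; last by move=> a aX _; apply: ag2'.
    by rewrite m26 ag2 // m'5.
  * exact: leqnn.
  * move=> m2 [ag2 m29]; split=> //.
    have -> : beval (State m2 r) (BAnd (qE 5) (BNle (reg 9) (NConst 0))) =
        beval (State m2 r) (qE 5) && (m2 9 <= 0) by [].
    rewrite beval_qE; last by rewrite ag2 // ag' // aga.
    rewrite m29 ag2 // m'5.
    congr (_ && _); apply: eq_inQ => d lt_d.
    transitivity (m (11 + d)); last exact: (digits_agree le_e ag lt_d).
    by rewrite ag2 ?ag' ?aga ?inE //; lia.
- have -> : bcost (BAnd (cE 6) (nearE 6 5)) =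
    (bcost (cE 6) + bcost (nearE 6 5)).+1 by [].
  by rewrite bcost_cE /=; lia.
move=> mb [agb mb8].
have agb' : agree [:: 4; 5; 6; 7; 8; 9] m mb.
  move=> a; rewrite !inE => aX; rewrite agb ?inE; last lia.
  by rewrite aga ?inE //; lia.
have domE : (mb 8 <= 0) = domi C (Qset u).
  rewrite mb8 leqn0 -card_set_count cards_eq0; apply/eqP/forall_inP => [h p | h].
    rewrite inE => pQ; move/setP/(_ p): h; rewrite !inE pQ /= => /negbT.
    rewrite -ltnNge -card_set_count => /card_gt0P [q]; rewrite inE => /andP [qC qp].
    by apply/exists_inP; exists q => //; rewrite CE.
  apply/setP => p; rewrite !inE; apply/negbTE; rewrite negb_and orbC -implybE.
  apply/implyP => hp; rewrite -/(inQ u p); apply/negP => pQ.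
  have /exists_inP [q qC qp] := h p ltac:(by rewrite inE).
  move: hp; rewrite leqn0 -card_set_count cards_eq0 => /eqP /setP /(_ q).
  by rewrite !inE -CE qC qp.
have cardE : mb 7 = #|C|.
  rewrite agb // ma7 -card_set_count; congr #|pred_of_set _|.
  by apply/setP => i; rewrite CE inE.
have setbe : setof mb e = setof m e.
  apply: eq_setof => i lt_i; apply: agb'; rewrite !inE; lia.
pose post m' := [/\ agree_block [:: 4; 5; 6; 7; 8; 9; 10] e n m m',
  m' 10 = #|setof m' e| & setof m' e =
    if domi C (Qset u) && (#|C| < #|setof m e|) then C else setof m e].
apply: wp_seq; apply: (@wp_conseq _ _ _ _ _ _ post).
- apply: (@wp_if _ _ _ _ _ (n * (bcost (cE 4) + 22) + 11 + 4)) => /=;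
    rewrite domE cardE addn1 agb' // m10 => hb.
  + apply: wp_seq; apply: wp_conseq.
    * apply: (wp_fill (n := n) (e := e) (beta := beta)).
      - by rewrite agb'.
      - rewrite agb' // ag //; lia.
      - lia.
      - move=> i m' lt_i ag' m'4; apply: cEE => // a aX ae.
        rewrite ag' //; last by apply: contra aX; rewrite !inE; lia.
        by apply: agb'.
    * exact: leqnn.
    move=> m' [ag' m'e].
    have m'C : setof m' e = C.
      by apply/setP => i; rewrite inE CE m'e ?eqb0 ?negbK.
    apply: wp_store; rewrite /=.
    have upC : setof (update m' 10 (m' 7)) e = C.
      rewrite -m'C; apply: eq_setof => i lt_i; rewrite /update.
      by case: eqP => //; lia.
    rewrite /post upC hb; split=> //.
      move=> a aX ae; have a10 : a <> 10 by move=> a10; rewrite a10 in aX.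
      move: aX; rewrite !inE => aX; rewrite /update; case: eqP => // _.
      rewrite ag' ?inE //; last lia.
      by rewrite agb' ?inE //; lia.
    by rewrite /update /= ag' ?cardE //; lia.
  + apply: (@wp_conseq _ _ _ 1); [apply: wp_skip|lia|by move=> m'; apply].
    rewrite /post setbe (negbTE hb); split=> //.
      by move=> a; rewrite !inE => aX _; rewrite agb' ?inE //; lia.
    by rewrite agb'.
- by rewrite bcost_cE /=; lia.
move=> m' [agp m'10 m'e].
apply: wp_conseq; first apply: wp_store; last by move=> m2; apply.
  rewrite /=.
  have upe : setof (update m' 3 (m' 3 + m' 1 + 1)) e = setof m' e.
    by apply: eq_setof => i lt_i; rewrite /update; case: eqP => //; lia.
  have up a : a <> 3 -> update m' 3 (m' 3 + m' 1 + 1) a = m' a.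
    by rewrite /update; case: eqP.
  split; last split; rewrite ?upe.
  + move=> a aX ae; have a3 : a <> 3 by move=> a3; rewrite a3 in aX.
    rewrite up // agp //; first exact: ag.
    by apply: contra aX; rewrite !inE; lia.
  + by rewrite /update /= !agp //; lia.
  + by rewrite up.
  + rewrite m'e; case: ifP => // _; exact: subsetUr.
  + by rewrite m'e; case: ifP => // /andP [].
  move=> j; rewrite ltnS leq_eqVlt => /predU1P [->|lt_j] dj.
    by rewrite m'e -/C dj /=; case: ltnP.
  rewrite m'e; apply: leq_trans (best _ lt_j dj).
  by case: ifP => // /andP [_ /ltnW].
by [].
Qed.

Lemma near_refl p : near p p.
Proof. by rewrite /near !subrr mulr0 addr0 ler01. Qed.

Definition Tstep l :=
  (n * 25 + 11) + (4 + (6 + ((l * (7 + Tcand).+1 + 8) + 9))).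

Lemma wp_step m0 L : rep m0 L ->
  wp r step (Tstep (size L)) m0 (fun m =>
    (forall d, d < nregs - 11 -> digits m d = digits m0 d) /\
    exists W, rep m (rcons L W) /\ good L (digits m0) W).
Proof.
move=> rep0; have [m01 m02 m0L] := rep0.
set e := base + size L * n.+1 in m02.
have le_e : base <= e by rewrite /e; lia.
have e16 : 15 < e by rewrite /base /nregs in le_e; lia.
have ke k i : k < size L -> i < n -> base + k * n.+1 + i < e.
  by rewrite /e => *; nia.
apply: wp_seq; apply: wp_conseq.
- apply: (wp_fill (n := n) (e := e) (beta := xpredT)) => //; lia.
- by rewrite /=.
move=> m1 [ag1 m1e].
apply: wp_seq; apply: wp_store; rewrite /=.
apply: wp_seq; apply: wp_store; rewrite /=.
set m2 := update _ 3 _.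
have ag2 : agree_block scratch e n m0 m2.
  move=> a; rewrite /m2 /update => aX ae.
  case: eqP => [a3|_]; first by rewrite a3 in aX.
  case: eqP => [a3|_]; first by rewrite a3 in aX.
  by rewrite ag1 //; apply: contra aX; rewrite !inE; lia.
have m2e : setof m2 e = setT.
  apply/setP => i; rewrite !inE /m2 /update.
  have -> : (e + i == 3) = false by lia.
  have -> : (e + i == 10) = false by lia.
  by rewrite m1e.
have m11 : m1 1 = n by rewrite ag1 //; lia.
have best0 : best_of m0 L e 0 m2.
  split=> //; first by rewrite /m2 /update /= m11 /base; lia.
    by rewrite m2e cardsT card_ord /m2 /update /= m11.
  rewrite m2e; split=> //.
  by apply/forall_inP => p _; apply/exists_inP; exists p; rewrite ?near_refl.
apply: wp_seq; apply: wp_conseq.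
- apply: (wp_while (I := best_of m0 L e) (N := size L) (T := Tcand)) best0.
  + move=> k m lt_k Ik; split; last exact: wp_candidate.
    have [ag m3 _ _] := Ik.
    have m_2 : m 2 = e by rewrite ag //; lia.
    by rewrite /= m3 m_2 /e; nia.
  + move=> m [ag m3 _ _].
    have m_2 : m 2 = e by rewrite ag //; lia.
    by rewrite /= m3 m_2 /e; lia.
- by rewrite /=; lia.
move=> m [ag m3 m10 [subT dom best]].
apply: wp_store; rewrite /=.
have m_1 : m 1 = n by rewrite ag //; lia.
have m_2 : m 2 = e by rewrite ag //; lia.
have upE a : a <> 2 -> update m 2 (m 2 + m 1 + 1) a = m a.
  by rewrite /update; case: eqP.
have setE a : 15 < a -> setof (update m 2 (m 2 + m 1 + 1)) a = setof m a.
  by move=> lt_a; apply: eq_setof => i lt_i; apply: upE; lia.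
split.
  move=> d lt_d; rewrite /digits upE; last lia.
  rewrite /base in le_e; apply: ag; last lia.
  by rewrite !inE; lia.
exists (setof m e); split.
  split.
  - by rewrite upE.
  - by rewrite /update /= m_1 m_2 size_rcons /e; lia.
  - move=> k; rewrite size_rcons ltnS leq_eqVlt => /predU1P [-> | lt_k].
      by rewrite nth_rcons ltnn eqxx setE.
    rewrite nth_rcons lt_k setE; last by rewrite /base /nregs; lia.
    rewrite -m0L //; apply: eq_setof => i lt_i; apply: ag.
      by rewrite !inE /base /nregs; lia.
    by have := ke _ _ lt_k lt_i; lia.
split=> // W0 W0L; move: (nth_index set0 W0L) => <-.
by apply: best; rewrite index_mem.
Qed.

Lemma good_ext L u u' W :
  (forall d, d < B.+3 -> u' d = u d) -> good L u W -> good L u' W.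
Proof.
move=> equ; suff [eT eQ] : Tset u' = Tset u /\ Qset u' = Qset u by rewrite /good eT eQ.
by split; apply/setP => i; rewrite !inE; [apply: eq_inT | apply: eq_inQ].
Qed.

Lemma good_sub L L1 u W : {subset L <= L1} -> good L1 u W -> good L u W.
Proof. by move=> sL [? ? best]; split=> // W0 /sL; apply: best. Qed.

Lemma rep_update m L c v : 2 < c < nregs -> rep m L -> rep (update m c v) L.
Proof.
move=> c3 [m1 m2 mL].
have upE a : a <> c -> update m c v a = m a by rewrite /update; case: eqP.
split; rewrite ?upE //; try lia.
move=> k lt_k; rewrite -mL //; apply: eq_setof => i lt_i.
by apply: upE; rewrite /base; lia.
Qed.

Definition same_from d m m' :=
  forall j, d <= j < B + 5 -> digits m' j = digits m j.

Fixpoint nest d P : cmd :=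
  if d is d'.+1 then for_ (11 + d') (NAdd (reg 1) (NConst 2)) (nest d' P) else P.

Fixpoint Tnest l d :=
  if d is d'.+1 then (n + 2) * (Tnest l d' + 4 + 12) + (4 + 9) else Tstep l.

Definition covers d m L L' := forall u,
  (forall j, j < d -> u j < n + 2) ->
  (forall j, d <= j < B.+3 -> u j = digits m j) ->
  exists2 W, W \in L' & good L u W.

Definition nest_post d m L m' := exists L',
  [/\ rep m' L', {subset L <= L'}, size L' <= size L + (n + 2) ^ d,
      same_from d m m' /\ covers d m L L' &
      forall j, j < d -> n <= digits m' j].

Lemma Tstep_leq l l' : l <= l' -> Tstep l <= Tstep l'.
Proof. by rewrite /Tstep => le_l; have := leq_mul le_l (leqnn (7 + Tcand).+1); lia. Qed.

Lemma same_from_update d m k : same_from d.+1 m (update m (11 + d) k).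
Proof. by move=> j lt_j; rewrite /digits /update; case: eqP => //; lia. Qed.

Lemma wp_nest l d m L : d <= B.+3 -> rep m L -> size L + (n + 2) ^ d <= l.+1 ->
  wp r (nest d step) (Tnest l d) m (nest_post d m L).
Proof.
elim: d m L => [|d IHd] m L le_d repL le_l.
  rewrite expn0 addn1 ltnS in le_l.
  apply: wp_conseq (wp_step repL) (Tstep_leq le_l) _ => m' [same [W [repW gW]]].
  exists (rcons L W); split=> //.
  - by move=> W0; rewrite mem_rcons inE => ->; rewrite orbT.
  - by rewrite size_rcons expn0 addn1.
  - split; first by move=> j lt_j; apply: same; rewrite /nregs; lia.
    move=> u _ equ; exists W; first by rewrite mem_rcons inE eqxx.
    by apply: good_ext gW => j lt_j; apply: equ.
pose I k m' := m' (11 + d) = k /\ exists L',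
  [/\ rep m' L', {subset L <= L'}, size L' <= size L + k * (n + 2) ^ d,
      same_from d.+1 m m' &
      (forall u, (forall j, j < d -> u j < n + 2) -> u d < k ->
        (forall j, d < j < B.+3 -> u j = digits m j) ->
        exists2 W, W \in L' & good L u W) /\
      (0 < k -> forall j, j < d -> n <= digits m' j)].
apply: wp_conseq.
- apply: (wp_for (I := I) (N := n + 2) (T := Tnest l d)).
  + by move=> k m' [-> [L' [[/= ->]]]].
  + split; first by rewrite /update eqxx.
    exists L; split=> //; first by apply: rep_update => //; rewrite /nregs; lia.
      by rewrite leq_addr.
    exact: same_from_update.
  + move=> k m1 lt_k [m1d [L1 [rep1 sub1 size1 same1 [cov1 null1]]]].
    have le_l1 : size L1 + (n + 2) ^ d <= l.+1.
      apply: leq_trans le_l; rewrite expnS.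
      apply: leq_trans (_ : size L + k.+1 * (n + 2) ^ d <= _).
        by rewrite mulSn; lia.
      by rewrite leq_add2l leq_mul2r lt_k orbT.
    apply: wp_conseq (IHd _ _ (ltnW le_d) rep1 le_l1) (leqnn _) _.
    move=> m2 [L2 [rep2 sub2 size2 [same2 cov2] null2]].
    split; first by rewrite -m1d; apply: (same2 d); lia.
    split; first by rewrite /update eqxx.
    exists L2; split.
    * by apply: rep_update => //; rewrite /nregs; lia.
    * by move=> W /sub1 /sub2.
    * by rewrite mulSn; lia.
    * move=> j lt_j; rewrite same_from_update // same2; last lia.
      by apply: same1.
    split.
      move=> u ltu; rewrite ltnS leq_eqVlt => /predU1P [ud equ | lt_u equ]; last first.
        by have [W /sub2 W1 gW] := cov1 u ltu lt_u equ; exists W.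
      have [|W W2 gW] := cov2 u ltu; last by exists W => //; apply: good_sub gW.
      move=> j; rewrite leq_eqVlt; case: eqP => [<- _|_ lt_j]; first by rewrite ud -m1d.
      by rewrite same1 ?equ //; lia.
    move=> _ j lt_j; rewrite /digits /update.
    by case: eqP => [|_]; [lia | apply: null2].
- by [].
move=> m' [m'd [L' [rep' sub' size' same' [cov' null']]]].
exists L'; split=> //.
- by rewrite expnS.
- split=> // u ltu equ; apply: cov' => //; first by move=> j lt_j; apply: ltu; lia.
  exact: ltu.
- move=> j; rewrite ltnS leq_eqVlt => /predU1P [-> | lt_j]; last by apply: null'; lia.
  by rewrite /digits m'd; lia.
Qed.

Definition round L L' := {subset L <= L'} /\
  forall u, (forall j, u j < n + 2) -> exists2 W, W \in L' & good L u W.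

Fixpoint rounds t L L' :=
  if t is t'.+1 then exists2 L1, rounds t' L L1 & round L1 L' else L = L'.

Lemma rounds_cat t1 t2 L1 L2 L3 :
  rounds t1 L1 L2 -> rounds t2 L2 L3 -> rounds (t2 + t1) L1 L3.
Proof.
move=> r1; elim: t2 L3 => [|t2 IH] L3 /=; first by move=> <-.
by move=> [L4 /IH r4 r43]; exists L4.
Qed.

Definition rounds_post t d m L m' := exists L',
  [/\ rep m' L', rounds t L L', size L' <= size L + (n + 2) ^ d,
      same_from d m m' & forall j, j < d -> n <= digits m' j].

Lemma wp_rounds l t d P T m L : B + 2 < d < B + 5 ->
  (forall m L, rep m L -> size L + (n + 2) ^ d <= l.+1 ->
     wp r P T m (rounds_post t d m L)) ->
  rep m L -> size L + (n + 2) ^ d.+1 <= l.+1 ->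
  wp r (for_ (11 + d) (NAdd (reg 1) (NConst 2)) P)
    ((n + 2) * (T + 4 + 12) + (4 + 9)) m (rounds_post ((n + 2) * t) d.+1 m L).
Proof.
move=> le_d HP repL le_l.
pose I k m' := m' (11 + d) = k /\ exists L',
  [/\ rep m' L', rounds (k * t) L L', size L' <= size L + k * (n + 2) ^ d,
      same_from d.+1 m m' & (0 < k -> forall j, j < d -> n <= digits m' j)].
apply: wp_conseq.
- apply: (wp_for (I := I) (N := n + 2) (T := T)).
  + by move=> k m' [-> [L' [[/= ->]]]].
  + split; first by rewrite /update eqxx.
    exists L; split=> //; first by apply: rep_update => //; rewrite /nregs; lia.
      by rewrite leq_addr.
    exact: same_from_update.
  + move=> k m1 lt_k [m1d [L1 [rep1 sub1 size1 same1 null1]]].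
    have le_l1 : size L1 + (n + 2) ^ d <= l.+1.
      apply: leq_trans le_l; rewrite expnS.
      apply: leq_trans (_ : size L + k.+1 * (n + 2) ^ d <= _).
        by rewrite mulSn; lia.
      by rewrite leq_add2l leq_mul2r lt_k orbT.
    apply: wp_conseq (HP _ _ rep1 le_l1) (leqnn _) _.
    move=> m2 [L2 [rep2 sub2 size2 same2 null2]].
    split; first by rewrite -m1d; apply: (same2 d); lia.
    split; first by rewrite /update eqxx.
    exists L2; split.
    * by apply: rep_update => //; rewrite /nregs; lia.
    * by rewrite mulSn; apply: rounds_cat sub2.
    * by rewrite mulSn; lia.
    * move=> j lt_j; rewrite same_from_update // same2; last lia.
      by apply: same1.
    move=> _ j lt_j; rewrite /digits /update.
    by case: eqP => [|_]; [lia | apply: null2].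
- by [].
move=> m' [m'd [L' [rep' sub' size' same' null']]].
exists L'; split=> //; first by rewrite expnS.
move=> j; rewrite ltnS leq_eqVlt => /predU1P [-> | lt_j]; last by apply: null'; lia.
by rewrite /digits m'd; lia.
Qed.

Lemma wp_nest_rounds l m L : rep m L -> size L + (n + 2) ^ (B + 5) <= l.+1 ->
  wp r (nest (B + 5) step) (Tnest l (B + 5)) m
    (rounds_post ((n + 2) * (n + 2)) (B + 5) m L).
Proof.
have H1 m1 L1 : rep m1 L1 -> size L1 + (n + 2) ^ B.+3 <= l.+1 ->
    wp r (nest B.+3 step) (Tnest l B.+3) m1 (rounds_post 1 B.+3 m1 L1).
  move=> rep1 le1; apply: wp_conseq (wp_nest (leqnn _) rep1 le1) (leqnn _) _.
  move=> m' [L' [rep' sub' size' [same' cov'] null']]; exists L'; split=> //.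
  exists L1 => //; split=> // u ltu; apply: cov' => [//|j].
  by rewrite leqNgt; case: ltnP.
have H2 m1 L1 : rep m1 L1 -> size L1 + (n + 2) ^ B.+4 <= l.+1 ->
    wp r (nest B.+4 step) (Tnest l B.+4) m1
      (rounds_post ((n + 2) * 1) B.+4 m1 L1).
  by move=> rep1 le1; apply: (wp_rounds _ H1) => //; lia.
have -> : B + 5 = B.+4.+1 by lia.
have -> : (n + 2) * (n + 2) = (n + 2) * ((n + 2) * 1) by rewrite muln1.
by move=> rep1 le1; apply: (wp_rounds _ H2) => //; lia.
Qed.

Fixpoint copy_down c : cmd :=
  if c is c'.+1 then
    Seq (NStore (NConst c) (NLoad (NAdd (reg 0) (NConst c)))) (copy_down c')
  else NStore (NConst 0) (NLoad (reg 0)).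

Lemma wp_copy_down z c m : m 0 = z -> c < z ->
  wp r (copy_down c) (7 * c + 5) m
    (fun m' => forall a, m' a = if a <= c then m (z + a) else m a).
Proof.
elim: c m => [|c IHc] m m0 lt_z.
  apply: wp_store => /= a; rewrite leqn0 m0 /update.
  by case: eqP => // ->; rewrite addn0.
apply: (@wp_conseq _ _ _ (7 + (7 * c + 5))); [apply: wp_seq|lia|by move=> m'; apply].
apply: wp_store; rewrite /=.
set m1 := update _ _ _.
apply: wp_conseq (IHc m1 _ (ltnW lt_z)) (leqnn _) _ => //.
move=> m' m'E a; rewrite m'E /m1 /update !eqn_leq m0.
case: (ltngtP a c.+1) => [lt_a|lt_a|->].
- have -> : a <= c by lia.
  by have -> : (z + a <= c.+1) = false by lia.
- by have -> : (a <= c) = false by lia.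
- by rewrite ltnn.
Qed.

(* The first nregs cells, registers included, are overwritten by straight-line
   code, the base pointer in cell 0 last. *)
Definition output_cmd : cmd :=
  Seq (NStore (NConst 0) (NSub (reg 2) (NAdd (reg 1) (NConst 1))))
 (Seq (NStore (NConst 3) (NConst nregs))
 (Seq (While (BNle (NAdd (reg 3) (NConst 1)) (reg 1))
        (Seq (NStore (reg 3) (NLoad (NAdd (reg 0) (reg 3))))
             (NStore (NConst 3) (NAdd (reg 3) (NConst 1)))))
   (copy_down nregs.-1))).

Definition Toutput := 9 + (3 + ((n * 25 + 8) + (7 * nregs + 5))).

Lemma wp_output z m : m 1 = n -> m 2 = z + n.+1 -> base <= z ->
  wp r output_cmd Toutput m (fun m' => forall i, i < n -> m' i = m (z + i)).
Proof.
move=> m_1 m_2 le_z.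
apply: wp_seq; apply: wp_store; rewrite /=.
apply: wp_seq; apply: wp_store; rewrite /=.
have -> : m 2 - (m 1 + 1) = z by lia.
set m1 := update _ 3 _.
have m1E a : a <> 0 -> a <> 3 -> m1 a = m a.
  by rewrite /m1 /update => /eqP/negbTE -> /eqP/negbTE ->.
rewrite /base in le_z.
pose I k m' := [/\ m' 3 = nregs + k,
  forall a, a <> 3 -> ~~ (nregs <= a < nregs + k) -> m' a = m1 a &
  forall a, nregs <= a < nregs + k -> m' a = m (z + a)].
apply: wp_seq; apply: wp_conseq.
- apply: (wp_while (I := I) (N := n - nregs) (T := 15)).
  + move=> k m' lt_k [m'3 m'E m'c].
    have m'1 : m' 1 = n by rewrite m'E ?m1E // /nregs; lia.
    have m'0 : m' 0 = z by rewrite m'E // /nregs; lia.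
    split; first by rewrite /= m'3 m'1; lia.
    apply: (@wp_seq _ _ _ _ 9 6); apply: wp_store; rewrite /=.
    apply: wp_conseq; first apply: wp_store; last by move=> m2; apply.
      rewrite /= m'3 m'0 /update.
      have -> : (3 == nregs + k) = false by rewrite /nregs; lia.
      rewrite m'3; split=> /=; first lia.
        move=> a a3 ak; case: eqP => // _.
        by case: eqP => [|_]; [lia | apply: m'E => //; lia].
      move=> a ak; case: eqP => [|_]; first by rewrite /nregs in ak; lia.
      case: eqP => [->|ak']; last by apply: m'c; lia.
      rewrite m'E ?m1E //; rewrite /nregs; lia.
    by [].
  + move=> m' [m'3 m'E m'c].
    have m'1 : m' 1 = n by rewrite m'E ?m1E // /nregs; lia.
    by rewrite /= m'3 m'1; lia.
  + split=> //; first by rewrite addn0.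
    by move=> a; lia.
- by rewrite /=; lia.
move=> m' [m'3 m'E m'c].
have m'0 : m' 0 = z by rewrite m'E // /nregs; lia.
apply: wp_conseq (wp_copy_down m'0 _) _ _.
- by rewrite /nregs in le_z *; lia.
- by lia.
move=> m2 m2E i lt_i; rewrite m2E; case: leqP => le_i.
  rewrite m'E ?m1E //; rewrite /nregs in le_z *; lia.
by apply: m'c; rewrite /nregs in le_i *; lia.
Qed.

Definition program : cmd :=
  Seq (NStore (NConst 1) (reg 0))
 (Seq (NStore (NConst 2) (NAdd (NAdd (reg 1) (reg 1)) (NConst nregs.+1)))
 (Seq (nest (B + 5) step)
 (Seq step output_cmd))).

Definition Tprogram l := 4 + (9 + (Tnest l (B + 5) + (Tstep l.+1 + Toutput))).

Lemma wp_program m : m 0 = n -> (forall a, 0 < a -> m a = 0) ->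
  wp r program (Tprogram ((n + 2) ^ (B + 5))) m (fun m' => exists L u W,
    [/\ rounds ((n + 2) * (n + 2)) [:: set0] L, forall j, j < B.+3 -> n <= u j,
        good L u W & forall i : 'I_n, (i \in W) = (m' i != 0)]).
Proof.
move=> m_0 m_z.
set l := (n + 2) ^ (B + 5).
apply: wp_seq; apply: wp_store; rewrite /=.
apply: wp_seq; apply: wp_store; rewrite /=.
set m1 := update _ 2 _.
have rep1 : rep m1 [:: set0].
  split=> //; first by rewrite /m1 /update /= m_0 /base; lia.
  move=> [] // _; apply/setP => i; rewrite !inE mul0n addn0 /m1 /update.
  have -> : (base + i == 2) = false by rewrite /base /nregs; lia.
  have -> : (base + i == 1) = false by rewrite /base /nregs; lia.
  by rewrite m_z //; rewrite /base /nregs; lia.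
apply: wp_seq; apply: wp_conseq (wp_nest_rounds (l := l) rep1 _) _ _ => //.
move=> m2 [L [rep2 rds le_L same2 null2]].
rewrite add1n in le_L.
apply: wp_seq; apply: wp_conseq (wp_step rep2) (Tstep_leq le_L) _.
move=> m3 [same3 [W [rep3 gW]]]; have [m3_1 m3_2 m3L] := rep3.
rewrite size_rcons mulSn in m3_2.
have m3_z : m3 2 = base + size L * n.+1 + n.+1 by lia.
apply: wp_conseq (wp_output m3_1 m3_z (leq_addr _ _)) (leqnn _) _ => m4 m4E.
exists L, (digits m2), W; split=> //.
  by move=> j lt_j; apply: null2; lia.
have := m3L (size L); rewrite size_rcons ltnSn nth_rcons ltnn eqxx => <- // i.
by rewrite inE m4E.
Qed.

End Step.

Section Rank.
Variables (n : nat) (f : 'I_n -> int).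
Local Open Scope ring_scope.

Definition below p : seq int := [seq f q | q <- enum 'I_n & f q < f p].
(* The dense rank of f p: unlike f it is bounded by n, and it still varies by
   at most 2 when f does. *)
Definition rank p : nat := size (undup (below p)).

Lemma mem_below p v :
  reflect (exists2 q, v = f q & f q < f p) (v \in undup (below p)).
Proof.
rewrite mem_undup; apply: (iffP mapP) => [[q]|[q -> lt_q]].
  by rewrite mem_filter => /andP [lt_q _] ->; exists q.
by exists q; rewrite // mem_filter lt_q mem_enum.
Qed.

Lemma rank_le p q : f p <= f q -> (rank p <= rank q)%N.
Proof.
move=> le_pq; apply: uniq_leq_size; first exact: undup_uniq.
move=> v /mem_below [s -> lt_s]; apply/mem_below; exists s => //.
exact: lt_le_trans le_pq.
Qed.

Lemma rank_lt p q : f p < f q -> (rank p < rank q)%N.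
Proof.
move=> lt_pq; rewrite -[(rank p).+1]/(size (f p :: undup (below p))).
apply: uniq_leq_size.
  rewrite /= undup_uniq andbT; apply/negP => /mem_below [s <-].
  by rewrite ltxx.
move=> v; rewrite inE => /predU1P [->|/mem_below [s -> lt_s]]; apply/mem_below.
  by exists p.
by exists s; rewrite // (lt_trans lt_s).
Qed.

Lemma rank_inj p q : rank p = rank q -> f p = f q.
Proof. by case: (ltgtP (f p) (f q)) => // /rank_lt; lia. Qed.

Lemma rank_bound p : (rank p < n)%N.
Proof.
apply: leq_ltn_trans (size_undup _) _; rewrite size_map size_filter.
rewrite -[X in (_ < X)%N](size_enum_ord n) -(count_predC (fun q => f q < f p)).
rewrite -addn1 leq_add2l -has_count; apply/hasP.
by exists p; rewrite ?mem_enum //= ltxx.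
Qed.

Lemma rank_near p q : f q <= f p + 2 -> (rank q <= rank p + 2)%N.
Proof.
move=> le_q; rewrite addn2 -[X in (_ <= X)%N]/(size [:: f p, f p + 1 & undup (below p)]).
apply: uniq_leq_size; first exact: undup_uniq.
move=> v /mem_below [s -> lt_s]; rewrite !inE.
case: (ltP (f s) (f p)) => [lt_sp|le_ps].
  by apply/orP; right; apply/orP; right; apply/mem_below; exists s.
lia.
Qed.

End Rank.

Section Cells.
Variables (R : realType) (r : nat -> R) (n : nat).
Local Open Scope ring_scope.

Lemma near_sym q p : near r q p = near r p q.
Proof. by rewrite /near; congr (_ <= _); ring. Qed.

Definition half_cell (f : nat -> R) (p : 'I_n) : int := Num.floor (2 * f p).

Lemma half_cell_near (f : nat -> R) (p q : 'I_n) :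
  f q <= f p + 1 -> half_cell f q <= half_cell f p + 2.
Proof.
move=> le_qp; rewrite -lerBlDr floor_ge_int intrB.
by have := floor_le (2 * f q); rewrite /half_cell; lra.
Qed.

Lemma half_cell_lt (f : nat -> R) (p q : 'I_n) :
  half_cell f p < half_cell f q -> f p < f q.
Proof.
apply: contraTT; rewrite -!leNgt => le_qp.
by apply: le_floor; rewrite ler_pM2l.
Qed.

Lemma half_cell_eq (f : nat -> R) (p q : 'I_n) :
  half_cell f p = half_cell f q -> `|f p - f q| <= 2^-1.
Proof.
rewrite /half_cell => eq_pq.
have := floor_itv (2 * f p); have := floor_itv (2 * f q); rewrite eq_pq intrD.
by move=> /andP [h1 h2] /andP [h3 h4]; rewrite ler_norml; apply/andP; split; lra.
Qed.

Lemma near_coord p q : near r p q -> -1 <= px r p - px r q /\ -1 <= py r p - py r q.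
Proof.
rewrite /near; set a := px r p - px r q; set b := py r p - py r q => le1.
have := sqr_ge0 (a + 1); have := sqr_ge0 (b + 1).
have := sqr_ge0 a; have := sqr_ge0 b.
by move=> hb ha hb1 ha1; clearbody a b; split; nra.
Qed.

Lemma cells_exist : exists row col : 'I_n -> nat,
  [/\ forall p, (row p < n)%N, forall p, (col p < n)%N,
      forall p q : 'I_n, near r p q -> (row q <= row p + 2)%N /\ (col q <= col p + 2)%N,
      forall p q : 'I_n, row p = row q -> col p = col q -> near r p q &
      (forall p q : 'I_n, (row p < row q)%N -> py r p < py r q) /\
      (forall p q : 'I_n, (col p < col q)%N -> px r p < px r q)].
Proof.
have mono (f : nat -> R) (p q : 'I_n) :
    (rank (half_cell f) p < rank (half_cell f) q)%N -> f p < f q.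
  move=> lt_pq; apply: half_cell_lt; rewrite ltNge; apply/negP => /rank_le; lia.
exists (rank (half_cell (py r))), (rank (half_cell (px r))); split.
- exact: rank_bound.
- exact: rank_bound.
- move=> p q le_pq; have [hx hy] := near_coord le_pq.
  by split; apply: rank_near; apply: half_cell_near; lra.
- move=> p q /rank_inj/half_cell_eq hy /rank_inj/half_cell_eq hx; rewrite /near.
  by move: hy hx; rewrite !ler_norml => /andP [? ?] /andP [? ?]; nra.
- by split; apply: mono.
Qed.

End Cells.

Section Threshold.
Variables (R : realType) (n : nat).

Lemma thr_level (f : nat -> R) (g : 'I_n -> nat) h :
  (forall p q, g p < g q -> (f p < f q)%R) ->
  exists2 a, a < n + 2 & forall p : 'I_n, thr n f p a = (g p < h).
Proof.
move=> mono; case: (pickP (fun q => h <= g q)) => [q0 hq0 | none].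
  case: (@Order.TotalTheory.arg_minP _ _ _ q0 (fun q => h <= g q)
    (fun q : 'I_n => f q) hq0) => q hq min_q.
  exists (q : nat); first by have := ltn_ord q; lia.
  move=> p; rewrite /thr leqNgt ltn_ord /=; case: ltnP => [lt_p | /min_q -> //].
  by rewrite -ltNge mono // (leq_trans lt_p).
exists n; first lia.
by move=> p; rewrite /thr leqnn ltnNge none.
Qed.

End Threshold.

Lemma rounds_split (R : realType) (r : nat -> R) n B t1 t2 (L1 L3 : seq {set 'I_n}) :
  rounds r B (t2 + t1) L1 L3 ->
  exists2 L2, rounds r B t1 L1 L2 & rounds r B t2 L2 L3.
Proof.
elim: t2 L3 => [|t2 IH] L3 /=; first by exists L3.
by move=> [L4 /IH [L2 r12 r24] r43]; exists L2 => //; exists L4.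
Qed.

Lemma tuple_exists n B (T : {set 'I_n}) a b c :
  #|T| <= B -> a < n + 2 -> b < n + 2 -> c < n + 2 ->
  exists u : nat -> nat,
    [/\ forall j, u j < n + 2, [/\ u 0 = a, u 1 = b & u 2 = c] & Tset n B u = T].
Proof.
move=> leT lta ltb ltc.
exists (nth n [:: a, b, c & [seq val i | i <- enum T]]); split=> //.
  case=> [|[|[|j]]] //=.
  case: (ltnP j (size [seq val i | i <- enum T])) => [lt_j|le_j].
    by have /mapP [i _ ->] := mem_nth n lt_j; have := ltn_ord i; rewrite /=; lia.
  by rewrite nth_default //; lia.
apply/setP => i; rewrite inE; apply/hasP/idP => [[j]|iT].
  rewrite mem_iota; case: j => [|[|[|j]]] //= _ /eqP.
  case: (ltnP j (size [seq val i | i <- enum T])) => [lt_j|le_j].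
    have /mapP [i' i'T ->] := mem_nth n lt_j.
    by move=> /val_inj <-; rewrite mem_enum in i'T.
  by rewrite nth_default // => ni; have := ltn_ord i; lia.
have iT' : val i \in [seq val i | i <- enum T] by apply: map_f; rewrite mem_enum.
exists (index (val i) [seq val i | i <- enum T]).+3; last by rewrite /= nth_index.
rewrite -index_mem size_map -cardE in iT'; have lt_i := leq_trans iT' leT.
by rewrite mem_iota; lia.
Qed.

Section Band.
Variables (R : realType) (r : nat -> R) (n K' : nat) (row col : 'I_n -> nat).
Hypothesis col_lo : forall p, 2 <= col p < n + 2.
Hypothesis row_hi : forall p, row p < n.
Hypothesis near_col : forall p q : 'I_n, near r p q -> col q <= col p + 2.
Hypothesis near_row : forall p q : 'I_n, near r p q -> row q <= row p + 2.
Hypothesis same_cell :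
  forall p q : 'I_n, row p = row q -> col p = col q -> near r p q.
Hypothesis row_mono : forall p q : 'I_n, row p < row q -> (py r p < py r q)%R.
Hypothesis col_mono : forall p q : 'I_n, col p < col q -> (px r p < px r q)%R.

Let K := K'.+1.

Lemma domiP (C Q : {set 'I_n}) :
  reflect (forall p, p \in Q -> exists2 q, q \in C & near r q p) (domi r C Q).
Proof.
apply: (iffP forall_inP) => h p /h; first by move/exists_inP.
by move=> ?; apply/exists_inP.
Qed.

Lemma domi_setT (Q : {set 'I_n}) : domi r setT Q.
Proof. by apply/domiP => p _; exists p => //; apply: near_refl. Qed.

Definition band s p := (row p + 2 + s) %/ K.
Definition band_set s b : {set 'I_n} := [set p | band s p == b].
Definition min_dom s b : {set 'I_n} :=
  [arg min_(D < (setT : {set 'I_n}) | domi r D (band_set s b)) #|D|].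

Lemma min_domP s b : domi r (min_dom s b) (band_set s b) /\
  forall D, domi r D (band_set s b) -> #|min_dom s b| <= #|D|.
Proof. by rewrite /min_dom; case: arg_minnP => //; apply: domi_setT. Qed.

Lemma window_bound s b c :
  #|[set p in min_dom s b | (c <= col p + 2) && (col p <= c + 2)]| <= 9 * K.
Proof.
have [/domiP domD minD] := min_domP s b.
set D := min_dom s b in domD minD *; set W := [set p in D | _].
pose Q := [set p in band_set s b | (c <= col p + 4) && (col p <= c + 4)].
pose kappa p : 'I_9 * 'I_K :=
  (inord (col p + 4 - c), inord ((row p + 2 + s) %% K)).
have kappaE p q : p \in Q -> q \in Q -> kappa p = kappa q ->
    row p = row q /\ col p = col q.
  rewrite !inE => /andP [/eqP bp /andP [cp1 cp2]] /andP [/eqP bq /andP [cq1 cq2]].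
  move=> [/(congr1 val) /= ec /(congr1 val) /= er].
  rewrite !inordK in ec er; try lia.
  split; last lia.
  suff : row p + 2 + s = row q + 2 + s by lia.
  by rewrite (divn_eq (row p + 2 + s) K) (divn_eq (row q + 2 + s) K)
    er -!/(band s _) bp bq.
(* One point per cell: the one of least index. *)
pose rep := [set p in Q | [forall q in Q, (kappa q == kappa p) ==> (p <= q)]].
have card_rep : #|rep| <= 9 * K.
  rewrite -[9]card_ord -[K]card_ord -card_prod.
  rewrite -(card_in_imset (f := kappa)) ?max_card // => p q.
  rewrite [p \in _]in_set [q \in _]in_set.
  move=> /andP [pQ /forall_inP hp] /andP [qQ /forall_inP hq] e.
  apply/val_inj/eqP; rewrite eqn_leq.
  by rewrite (implyP (hp q _)) ?e ?(implyP (hq p _)) ?e.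
have domD' : domi r ((D :\: W) :|: rep) (band_set s b).
  apply/domiP => p pb; have [q qD qp] := domD p pb.
  case: (boolP (q \in W)) => [qW | qW]; last first.
    by exists q; rewrite // in_setU in_setD qW qD.
  have pQ : p \in Q.
    have pq : near r p q by rewrite near_sym.
    move: qW; rewrite !inE => /andP [_ /andP [h1 h2]]; rewrite inE in pb; rewrite pb.
    by have := near_col qp; have := near_col pq; lia.
  have pQk : (p \in Q) && (kappa p == kappa p) by rewrite pQ eqxx.
  case: (@arg_minnP _ p (fun z => (z \in Q) && (kappa z == kappa p)) val pQk).
  move=> z /andP [zQ /eqP zp] zmin; exists z.
    rewrite inE; apply/orP; right; rewrite inE zQ; apply/forall_inP => q' q'Q.
    by apply/implyP => /eqP q'z; apply: zmin; rewrite q'Q q'z zp eqxx.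
  by have [er ec] := kappaE _ _ zQ pQ zp; apply: same_cell.
have le1 := minD _ domD'; have le2 := (leq_card_setU (D :\: W) rep).1.
have WD : D :&: W = W by apply/setIidPr/subsetP => p; rewrite inE => /andP [].
by have := cardsID W D; rewrite WD; lia.
Qed.

Definition stage s b c : {set 'I_n} :=
  [set p | (band s p < b) || ((band s p == b) && (col p < c))].

Lemma band_mono s p q : band s p < band s q -> row p < row q.
Proof.
rewrite ltnNge => /negP h; rewrite ltnNge; apply/negP => le_qp; apply: h.
by apply: leq_div2r; lia.
Qed.

Lemma stage_Qset s b c : exists u0 u1 u2,
  [/\ u0 < n + 2, u1 < n + 2, u2 < n + 2 &
    forall u, u 0 = u0 -> u 1 = u1 -> u 2 = u2 -> Qset r n u = stage s b c].
Proof.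
have mono p q : band s p < band s q -> (py r p < py r q)%R.
  by move=> /band_mono; apply: row_mono.
have [u0 lt0 h0] := thr_level b mono; have [u1 lt1 h1] := thr_level b.+1 mono.
have [u2 lt2 h2] := thr_level c col_mono.
exists u0, u1, u2; split=> // u e0 e1 e2; apply/setP => p; rewrite !inE /inQ.
by rewrite e0 e1 e2 h0 h1 h2 ltnS; case: (ltngtP (band s p) b).
Qed.

Let B := 9 * K.

(* The state of the dynamic program: the bands before b and the columns before c
   of band b have been treated. *)
Definition reached s (L : seq {set 'I_n}) b c : Prop := exists2 W : {set 'I_n}, W \in L &
  [/\ forall p, p \in min_dom s b -> c <= col p + 2 -> col p < c + 2 -> p \in W,
      domi r W (stage s b c) &
      #|W| <= \sum_(i < b) #|min_dom s i| + #|[set p in min_dom s b | col p < c + 2]|].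

Lemma reached_step s L L' b c :
  reached s L b c -> round r B L L' -> reached s L' b c.+1.
Proof.
move=> [W WL [subW /domiP domW leW]] [_ cov].
pose T := [set p in min_dom s b | (c <= col p + 2) && (col p <= c + 2)].
have [u0 [u1 [u2 [lt0 lt1 lt2 eQ]]]] := stage_Qset s b c.+1.
have [u [ltu [e0 e1 e2] eT]] := tuple_exists (window_bound s b c) lt0 lt1 lt2.
have [W' W'L' [subT' domW' best]] := cov u ltu.
rewrite eT (eQ u) // in subT' domW' best.
exists W' => //; split=> //.
  move=> p pD h1 h2; apply: (subsetP subT'); rewrite inE pD; lia.
have domWT : domi r (W :|: T) (stage s b c.+1).
  apply/domiP => p; rewrite inE => hp.
  case: (boolP (p \in stage s b c)) => [/domW [q qW qp] | ps].
    by exists q; rewrite // inE qW.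
  have [pb pc] : band s p == b /\ col p = c by move: hp ps; rewrite inE; lia.
  have [/domiP domD _] := min_domP s b.
  have [|q qD qp] := domD p; first by rewrite inE.
  exists q => //; rewrite inE; apply/orP; right; rewrite inE qD.
  have pq : near r p q by rewrite near_sym.
  by have := near_col qp; have := near_col pq; lia.
have le1 := best W WL domWT.
pose X := [set p in min_dom s b | col p == c + 2].
have le2 : #|W :|: T| <= #|W| + #|X|.
  apply: leq_trans (leq_card_setU W X).1; apply: subset_leq_card.
  apply/subsetP => p; rewrite in_setU => /orP [pW | ]; first by rewrite inE pW.
  rewrite !inE => /andP [pD /andP [h1 h2]]; rewrite pD.
  case: (ltnP (col p) (c + 2)) => h3; last by apply/orP; right; lia.
  by rewrite subW.
set A := [set p in min_dom s b | col p < c + 2] in leW.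
have : #|A| + #|X| <= #|[set p in min_dom s b | col p < c.+1 + 2]|.
  rewrite -cardsUI (_ : A :&: X = set0) ?cards0 ?addn0; last first.
    by apply/setP => p; rewrite !inE; lia.
  by apply: subset_leq_card; apply/subsetP => p; rewrite !inE; lia.
move=> le3; apply: leq_trans le1 (leq_trans le2 _).
apply: leq_trans (leq_add leW (leqnn #|X|)) _.
by rewrite -addnA leq_add2l.
Qed.

Lemma reached_rounds s L L' b c t :
  reached s L b c -> rounds r B t L L' -> reached s L' b (c + t).
Proof.
move=> reL; elim: t L' => [|t IH] L' /=; first by move=> <-; rewrite addn0.
by move=> [L1 /IH reL1 rd]; rewrite addnS; apply: reached_step rd.
Qed.

Lemma low_empty (D : {set 'I_n}) : [set p in D | col p < 0 + 2] = set0.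
Proof.
apply/setP => p; rewrite !inE; have := col_lo p.
by case: (p \in D) => //=; lia.
Qed.

Lemma reached_band s L b : reached s L b (n + 2) -> reached s L b.+1 0.
Proof.
move=> [W WL [_ domW leW]]; exists W => //; split.
- by move=> p _ _; have := col_lo p; lia.
- suff -> : stage s b.+1 0 = stage s b (n + 2) by [].
  apply/setP => p; rewrite !inE; have := col_lo p; lia.
- rewrite low_empty cards0 addn0 big_ord_recr /=; apply: leq_trans leW _.
  rewrite leq_add2l; apply: subset_leq_card.
  by apply/subsetP => p; rewrite inE => /andP [].
Qed.

Lemma reached_all s L t : rounds r B ((n + 2) * t) [:: set0] L -> reached s L t 0.
Proof.
elim: t L => [|t IH] L.
  rewrite muln0 => <-; exists set0; first by rewrite inE.
  split=> [p _ _||].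
  - by have := col_lo p; lia.
  - by apply/domiP => p; rewrite inE ltn0 ltn0 andbF.
  - by rewrite cards0.
rewrite mulnS => /rounds_split [L1 /IH re1 rd].
by apply: reached_band; rewrite -(add0n (n + 2)); apply: reached_rounds rd.
Qed.

Lemma band_bound s p : s < K -> band s p < n + 2.
Proof.
move=> lt_s; rewrite ltn_divLR //; have := row_hi p.
by rewrite /K in lt_s *; nia.
Qed.

Lemma rounds_total s L : s < K -> rounds r B ((n + 2) * (n + 2)) [:: set0] L ->
  exists2 W : {set 'I_n}, W \in L &
    domi r W setT /\ #|W| <= \sum_(b < n + 2) #|min_dom s b|.
Proof.
move=> lt_s /(reached_all s) [W WL [_ domW]].
rewrite low_empty cards0 addn0 => leW; exists W => //; split=> //.
suff <- : stage s (n + 2) 0 = setT by [].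
by apply/setP => p; rewrite !inE band_bound.
Qed.

(* Hermite's identity. *)
Lemma sum_divn x : \sum_(s < K) (x + s) %/ K = x.
Proof.
elim: x => [|x IHx]; first by rewrite big1 // => s _; rewrite add0n divn_small.
have : \sum_(s < K.+1) (x + s) %/ K = x + (x + K) %/ K by rewrite big_ord_recr /= IHx.
rewrite big_ord_recl /= addn0 divnDr ?dvdnn // divnn /=.
under eq_bigr => s _ do rewrite /bump leq0n addnA addn1.
by lia.
Qed.

Lemma sum_interval m lo hi : \sum_(b < m) (lo <= b <= hi) <= hi.+1 - lo.
Proof.
suff : \sum_(b < m) (lo <= b <= hi) <= minn m hi.+1 - lo by lia.
elim: m => [|m IHm]; first by rewrite big_ord0.
rewrite big_ord_recr /=; move: (\sum_(_ < m) _) IHm => S.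
by case: (boolP (lo <= m <= hi)) => /=; lia.
Qed.

Lemma min_dom_le (O : {set 'I_n}) s b : domi r O setT ->
  #|min_dom s b| <= \sum_(p in O) ((row p + s) %/ K <= b <= (row p + 4 + s) %/ K).
Proof.
move=> /domiP domO.
pose O' := [set p in O | (row p + s) %/ K <= b <= (row p + 4 + s) %/ K].
have -> : \sum_(p in O) ((row p + s) %/ K <= b <= (row p + 4 + s) %/ K) = #|O'|.
  rewrite -sum1_card big_mkcond [RHS]big_mkcond; apply: eq_bigr => p _.
  by rewrite inE; case: (p \in O); case: (_ <= _ <= _).
apply: (min_domP s b).2; apply/domiP => p; rewrite inE => /eqP pb.
have [|q qO qp] := domO p; first by rewrite inE.
exists q; rewrite // inE qO -pb /band /=.
have pq : near r p q by rewrite near_sym.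
have := near_row qp; have := near_row pq => h1 h2.
by rewrite !leq_div2r //; lia.
Qed.

Lemma sum_min_dom (O : {set 'I_n}) : domi r O setT ->
  \sum_(s < K) \sum_(b < n + 2) #|min_dom s b| <= #|O| * (K + 4).
Proof.
move=> domO.
apply: (@leq_trans (\sum_(s < K) \sum_(p in O)
  ((row p + 4 + s) %/ K - (row p + s) %/ K + 1))).
  apply: leq_sum => s _.
  apply: (@leq_trans (\sum_(b < n + 2) \sum_(p in O)
    ((row p + s) %/ K <= b <= (row p + 4 + s) %/ K))).
    by apply: leq_sum => b _; apply: min_dom_le.
  rewrite exchange_big /=; apply: leq_sum => p _.
  apply: leq_trans (sum_interval _ _ _) _.
  have : (row p + s) %/ K <= (row p + 4 + s) %/ K by apply: leq_div2r; lia.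
  by lia.
rewrite exchange_big /= -sum_nat_const; apply: leq_sum => p _.
rewrite big_split /= sum_nat_const card_ord muln1 addnC leq_add2l.
suff : \sum_(s < K) ((row p + 4 + s) %/ K - (row p + s) %/ K) +
   \sum_(s < K) (row p + s) %/ K = row p + 4
  by rewrite sum_divn addnC => /eqP; rewrite eqn_add2l => /eqP ->.
rewrite -big_split /= -[RHS]sum_divn; apply: eq_bigr => s _.
by apply: subnK; apply: leq_div2r; lia.
Qed.

Lemma rounds_approx L (O : {set 'I_n}) : domi r O setT ->
  rounds r B ((n + 2) * (n + 2)) [:: set0] L ->
  exists2 W : {set 'I_n}, W \in L & domi r W setT /\ K * #|W| <= (K + 4) * #|O|.
Proof.
move=> domO rds.
case: (boolP [exists s : 'I_K, K * \sum_(b < n + 2) #|min_dom s b| <= (K + 4) * #|O|]).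
  move=> /existsP [s le_s]; have [W WL [domW leW]] := rounds_total (ltn_ord s) rds.
  exists W => //; split=> //; apply: leq_trans le_s.
  by rewrite leq_mul2l leW orbT.
rewrite negb_exists => /forallP h.
have := sum_min_dom domO; rewrite -(leq_pmul2l (_ : 0 < K)) // big_distrr /= => le1.
have : \sum_(s < K) ((K + 4) * #|O|).+1 <=
    \sum_(s < K) K * \sum_(b < n + 2) #|min_dom s b|.
  by apply: leq_sum => s _; rewrite ltnNge; apply: h.
rewrite sum_nat_const card_ord => le2; have := leq_trans le2 le1.
by rewrite (mulnC #|O|) leq_pmul2l // ltnn.
Qed.

End Band.

Lemma rounds_ratio (R : realType) (r : nat -> R) n K' L (O : {set 'I_n}) :
  domi r O setT -> rounds r (9 * K'.+1) ((n + 2) * (n + 2)) [:: set0] L ->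
  exists2 W : {set 'I_n}, W \in L &
    domi r W setT /\ K'.+1 * #|W| <= (K'.+1 + 4) * #|O|.
Proof.
have [row [col [row_lt col_lt near_rc cell [row_mono col_mono]]]] := cells_exist r n.
apply: (@rounds_approx _ r n K' row (fun p => col p + 2)).
- by move=> p; have := col_lt p; lia.
- exact: row_lt.
- by move=> p q /near_rc [_]; lia.
- by move=> p q /near_rc [].
- by move=> p q er /addIn; apply: cell.
- exact: row_mono.
- by move=> p q; rewrite ltn_add2r; apply: col_mono.
Qed.

Lemma good_null (R : realType) (r : nat -> R) n B (L : seq {set 'I_n}) u W :
  (forall j, j < B.+3 -> n <= u j) -> good r B L u W ->
  domi r W setT /\ forall W0, W0 \in L -> domi r W0 setT -> #|W| <= #|W0|.
Proof.
move=> null [_]; have -> : Tset n B u = set0.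
  apply/setP => i; rewrite !inE; apply/hasP => -[j]; rewrite mem_iota => lt_j.
  by have := null j; have := ltn_ord i; lia.
have -> : Qset r n u = setT by apply/setP => i; rewrite !inE /inQ /thr null.
move=> domW best; split=> // W0 W0L dom0.
by have := best W0 W0L; rewrite setU0; apply.
Qed.

Section Cost.
Variables n B : nat.
Let X := n + 2.

Lemma Tstep_bound l : Tstep n B l + 45 <= 64 * nregs B * X ^ 2 * l.+2.
Proof.
have h : 7 + (Tcand n B).+1 <= 64 * nregs B * X ^ 2.
  rewrite /Tcand /nregs /X; nia.
have := leq_mul (leqnn l) h; rewrite /Tstep /nregs /X in h *; nia.
Qed.

Lemma Tnest_bound l d : Tnest n B l d + 45 <= X ^ d * (Tstep n B l + 45).
Proof.
elim: d => [|d IHd]; first by rewrite mul1n.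
rewrite expnS -mulnA; apply: leq_trans (leq_mul (leqnn X) IHd).
by rewrite /= /X; nia.
Qed.

Lemma Tprogram_bound : Tprogram n B (X ^ (B + 5)) <= X ^ (3 * B + 40).
Proof.
set l := X ^ (B + 5).
have X2 : 2 <= X by rewrite /X; lia.
have l1 : 1 <= l by rewrite expn_gt0; lia.
set c := 64 * nregs B * X ^ 2.
have h1 := Tnest_bound l (B + 5); rewrite -/l in h1.
have h2 := Tstep_bound l; have h3 := Tstep_bound l.+1; rewrite -/c in h2 h3.
have h4 : Toutput n B + 13 <= c.
  by rewrite /c /Toutput /nregs /X; nia.
have h5 : Tprogram n B l <= c * (l * l * 8).
  have h6 := leq_mul (leqnn l) h2.
  rewrite /Tprogram.
  have : l * (c * l.+2) + c * l.+3 + c <= c * (l * l * 8) by nia.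
  lia.
apply: leq_trans h5 _.
have hb : nregs B <= X ^ (B + 16).
  by apply: leq_trans (ltnW (ltn_expl _ X2)) _; rewrite leq_exp2l.
have h64 : 64 <= X ^ 6 by rewrite (leq_exp2r 2 X (isT : 0 < 6)).
have h8 : 8 <= X ^ 3 by rewrite (leq_exp2r 2 X (isT : 0 < 3)).
have -> : X ^ (3 * B + 40) = X ^ 6 * X ^ (B + 16) * X ^ 2 * (l * l * X ^ 3) * X ^ 3.
  by rewrite /l -!expnD; congr (_ ^ _); lia.
rewrite -[leqLHS]muln1; apply: leq_mul; last by rewrite expn_gt0; lia.
by rewrite /c !leq_mul.
Qed.

End Cost.

Lemma Tprogram_exp n k : 0 < k ->
  Tprogram n (36 * k) ((n + 2) ^ (36 * k + 5)) <= maxn 2 n ^ (300 * k).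
Proof.
move=> k0; apply: leq_trans (Tprogram_bound n (36 * k)) _.
have le2 : n + 2 <= maxn 2 n ^ 2 by rewrite -mulnn; nia.
apply: leq_trans (_ : _ <= (maxn 2 n ^ 2) ^ (3 * (36 * k) + 40)) _.
  by rewrite leq_exp2r //; lia.
rewrite -expnM; apply: leq_pexp2l; lia.
Qed.

Section Points.
Variables (R : realType) (s : seq (R * R)).
Hypothesis uniq_s : uniq s.
Local Open Scope fset_scope.

Let r : nat -> R := rmem (input s).
Let n := size s.

Lemma input_near (q p : nat) :
  near r q p = (edist (nth (0, 0)%R s q) (nth (0, 0)%R s p) <= 1)%R.
Proof.
rewrite /near /px /py /r /input /= !addn1 /= !addnn.
rewrite !odd_double /= !uphalf_double !doubleK.
by rewrite /edist -[in RHS]sqrtr1 ler_sqrt ?ler01 // !expr2.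
Qed.

Variables (st : state R) (W : {set 'I_n}).
Hypothesis W_nmem : forall i : 'I_n, (i \in W) = (nmem st i != 0).

Lemma mem_output (i : 'I_n) : (nth (0, 0)%R s i \in output s st) = (i \in W).
Proof.
by rewrite inE in_mask // mem_nth // index_uniq // nth_mkseq // W_nmem.
Qed.

Lemma card_output : #|` output s st| = #|W|.
Proof.
rewrite card_fseq undup_id ?mask_uniq // size_mask ?size_mkseq // count_map.
rewrite -card_set_count; congr #|pred_of_set _|.
by apply/setP => i; rewrite inE W_nmem.
Qed.

Lemma mem_nth_ord p : p \in s -> exists i : 'I_n, p = nth (0, 0)%R s i.
Proof.
move=> ps; have lt_i : index p s < n by rewrite index_mem.
by exists (Ordinal lt_i); rewrite nth_index.
Qed.

Lemma output_dominating (S : {fset R * R}) :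
  s =i S -> domi r W setT -> dominating_set S (output s st).
Proof.
move=> sS /domiP domW; split.
  by apply/fsubsetP => p; rewrite inE => /mem_mask; rewrite sS.
move=> p; rewrite -sS => /mem_nth_ord [i ->].
have [|j jW ji] := domW i; first by rewrite inE.
by exists (nth (0, 0)%R s j); rewrite ?mem_output // -input_near.
Qed.

Lemma dominating_domi (S D : {fset R * R}) :
  s =i S -> dominating_set S D ->
  exists2 O : {set 'I_n}, domi r O setT & #|O| <= #|` D|.
Proof.
move=> sS [DS domD]; pose O : {set 'I_n} := [set i : 'I_n | nth (0, 0)%R s i \in D].
exists O.
  apply/domiP => i _; have [|q qD qi] := domD (nth (0, 0)%R s i).
    by rewrite -sS mem_nth.
  have [|j qj] := @mem_nth_ord q; first by rewrite sS (fsubsetP DS).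
  by rewrite qj in qD qi; exists j; rewrite ?inE // input_near.
rewrite cardE -(size_map (fun i : 'I_n => nth (0, 0)%R s i)).
apply: uniq_leq_size => [|p /mapP [i]]; last first.
  by rewrite mem_enum inE => iD ->.
rewrite map_inj_uniq ?enum_uniq // => i j /eqP.
by rewrite nth_uniq // => /eqP /val_inj.
Qed.

End Points.

Local Open Scope fset_scope.
Local Open Scope ring_scope.

Theorem theorem5 (R : realType) :
  exists c : nat, forall k : nat, (0 < k)%N ->
    exists P : cmd, forall (S : {fset R * R}) (s : seq (R * R)),
      uniq s -> s =i S ->
      exists (t : nat) (st : state R),
        [/\ exec P (input s) t st,
            (t <= maxn 2 #|` S| ^ (c * k))%N,
            dominating_set S (output s st)
          & forall OPT : {fset R * R}, minimum_dominating_set S OPT ->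
              (#|` output s st|)%:R
                <= (1 + 1 / k%:R) ^+ 2 * (#|` OPT|)%:R :> R].
Proof.
exists 300%N => k k0; exists (program (36 * k)) => S s uniq_s sS.
have cardS : #|` S| = size s.
  by apply/esym/perm_size; apply: uniq_perm => //; apply: fset_uniq.
have [||t [m [ex le_t [L [u [W [rds null gW W_nmem]]]]]]] :=
  @wp_program R (rmem (input s)) (size s) (36 * k) (nmem (input s)).
- by [].
- by case.
set st := State m (rmem (input s)); exists t, st.
have W_st : forall i, (i \in W) = (nmem st i != 0%N) by exact: W_nmem.
have [domW best] := good_null null gW.
split.
- exact: ex.
- by rewrite cardS; apply: leq_trans le_t (Tprogram_exp _ k0).
- exact: (output_dominating uniq_s W_st sS domW).
- move=> OPT [dom_OPT _].
  rewrite (card_output uniq_s W_st).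
  have [O domO leO] := dominating_domi uniq_s sS dom_OPT.
  have [K' eK] : exists K', (4 * k = K'.+1)%N by exists (4 * k).-1; lia.
  have e36 : (36 * k = 9 * K'.+1)%N by rewrite -eK; lia.
  rewrite e36 in rds.
  have [W0 W0L [dom0 le0]] := rounds_ratio domO rds.
  have leW := best W0 W0L dom0.
  have : (k * #|W| <= (k + 1) * #|` OPT|)%N by rewrite -eK in le0; nia.
  rewrite -(ler_nat R) !natrM natrD => le_k.
  have kR : 0 < k%:R :> R by rewrite ltr0n.
  have le1 : #|W|%:R <= (1 + 1 / k%:R) * #|` OPT|%:R :> R.
    rewrite -(ler_pM2l kR); apply: le_trans le_k _.
    by rewrite mulrA mulrDr mulr1 mulrCA mulfV ?gt_eqF // mulr1.
  apply: le_trans le1 _; rewrite ler_wpM2r ?ler0n // expr2 ler_peMl //.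
    by rewrite addr_ge0 ?ler01 // divr_ge0 ?ler01 ?ler0n.
  by rewrite lerDl divr_ge0 ?ler01 ?ler0n.
Qed.
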